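(* Let $(x_i,f_i)_{i\in\mathbb{N}}\subset X\times X^*$ be a Schauder frame of a Banach space $X$ and assume that for all $m\in\mathbb{N}$ $$\lim_{n\to\infty}\big\|f_m|_{\mathrm{span}(x_i:i\ge n)}\big\|=0.$$ Then the following are equivalent. (1) $(x_i,f_i)$ is shrinking. (2) Every normalized block sequence of $(x_i)$ is weakly null. (3) $X^*=\overline{\mathrm{span}(f_i:i\in\mathbb{N})}$ (norm closure). (4) The minimal associated basis $(e_i^{Min})$ to $(x_i,f_i)$ is a shrinking basis of the minimal associated space $Z_{Min}$.
   Context: All Banach spaces are over $\mathbb{R}$. $c_{00}$ is the space of eventually vanishing scalar sequences, with unit vector basis $(e_i)$. Let $X$ be a separable Banach space. A sequence $(x_i,f_i)_{i\in\mathbb{N}}$ with $x_i\in X$, $f_i\in X^*$ is a (Schauder) frame of $X$ if for every $x\in X$, $x=\sum_{i=1}^\infty f_i(x)x_i$ with norm convergence of the partial sums. Convention: $x_i\ne 0$ and $f_i\neq 0$ for all $i$. For $f\in X^*$ and a subspace $E\subset X$, $\|f|_E\|$ is the norm of the restriction of $f$ to $E$. The frame $(x_i,f_i)$ is locally shrinking if for all $m$, $\|f_m|_{\mathrm{span}(x_i:i\ge n)}\|\to 0$ as $n\to\infty$; pre-shrinking if $(f_i,x_i)$ is a frame of $X^*$, i.e. $f=\sum_{i=1}^\infty f(x_i)f_i$ in norm for every $f\in X^*$; shrinking if it is locally shrinking and pre-shrinking. A block sequence of $(x_i)$ is a sequence of vectors $u_n=\sum_{i=k_{n-1}+1}^{k_n}a_ix_i$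 with $0\le k_0<k_1<k_2<\dots$ and scalars $a_i$; it is normalized if $\|u_n\|=1$ for all $n$. Minimal associated space and basis: $Z_{Min}$ is the completion of $c_{00}$ under the norm $\|\sum a_ie_i\|_{Min}=\max_{m\le n}\|\sum_{i=m}^n a_ix_i\|_X$; the unit vectors form a basis of $Z_{Min}$, denoted $(e_i^{Min})$. A basis of a Banach space is shrinking if its coordinate functionals have dense linear span in the dual. *)

(* Defs.v *)
From HB Require Import structures.
From mathcomp Require Import all_boot all_order all_algebra.
From mathcomp Require Import all_classical all_reals all_analysis.

Set Implicit Arguments.
Unset Strict Implicit.
Unset Printing Implicit Defensive.

Import Order.TTheory GRing.Theory Num.Theory.
Import numFieldNormedType.Exports.

Local Open Scope classical_set_scope.
Local Open Scope ring_scope.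

Section Dual.
Context {R : realType} {X : normedModType R}.

Definition dual_pred : {pred X -> R^o} :=
  [pred f | `[< linear f /\ continuous f >]].

Record dual := Dual {dual_val :> X -> R^o; dual_valP : dual_val \in dual_pred}.

HB.instance Definition _ := [isSub for dual_val].
HB.instance Definition _ := [Choice of dual by <:].

Lemma dual_linear (f : dual) : linear f.
Proof. by have /asboolP[] := dual_valP f. Qed.

Lemma dual_continuous (f : dual) : continuous f.
Proof. by have /asboolP[] := dual_valP f. Qed.

HB.instance Definition _ (f : dual) :=
  GRing.isLinear.Build R X R^o _ (dual_val f) (dual_linear f).

Lemma dual_submod_closed : submod_closed dual_pred.
Proof.
split.
  apply/asboolP; split=> [a u v|]; last exact: cst_continuous.
  by rewrite /= scaler0 addr0.
move=> a f g /asboolP[lf cf] /asboolP[lg cg]; apply/asboolP; split=> [b u v|x].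
  rewrite !fctE lf lg !scalerDr !scalerA (mulrC a b) !addrA.
  by congr (_ + _); rewrite -!addrA; congr (_ + _); rewrite addrC.
apply: continuousD; [|exact: cg].
by apply: continuousZl_tmp; exact: cf.
Qed.

HB.instance Definition _ :=
  GRing.isSubmodClosed.Build R (X -> R^o) dual_pred dual_submod_closed.
HB.instance Definition _ := [SubChoice_isSubLmodule of dual by <:].

(* The norm of the restriction of [f] to the subspace [E]. *)
Definition restr_norm (f : dual) (E : set X) : R :=
  sup [set `|f v| | v in [set v | E v /\ `|v| <= 1]].

Lemma restr_norm_ubound (f : dual) :
  has_ubound [set `|f v| | v in [set v | setT v /\ `|v| <= 1]].
Proof.
have /linear_bounded_continuous/linear_boundedP/pinfty_ex_gt0[M M0 fM] :=
  @dual_continuous f.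
exists M => _ [v [_ v1] <-]; apply: (le_trans (fM v)).
by rewrite -[leRHS]mulr1 ler_wpM2l// ltW.
Qed.

Lemma restr_norm_set0 (f : dual) :
  [set `|f v| | v in [set v | setT v /\ `|v| <= 1]] 0.
Proof. by exists 0; rewrite ?linear0 ?normr0//= normr0; split. Qed.

Lemma dual_norm_ge (f : dual) v : `|v| <= 1 -> `|f v| <= restr_norm f setT.
Proof.
move=> v1; apply: sup_upper_bound; last by exists v.
by split; [exists 0; exact: restr_norm_set0 | exact: restr_norm_ubound].
Qed.

Lemma dual_norm_le (f : dual) M :
  (forall v, `|v| <= 1 -> `|f v| <= M) -> restr_norm f setT <= M.
Proof.
move=> fM; apply: ge_sup; first by exists 0; exact: restr_norm_set0.
by move=> _ [v [_ v1] <-]; exact: fM.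
Qed.

Lemma dual_normD (f g : dual) :
  restr_norm (f + g) setT <= restr_norm f setT + restr_norm g setT.
Proof.
apply: dual_norm_le => v v1; apply: (le_trans (ler_normD _ _)).
by rewrite lerD// dual_norm_ge.
Qed.

Lemma dual_norm0_eq0 (f : dual) : restr_norm f setT = 0 -> f = 0.
Proof.
move=> f0; apply: val_inj; apply/funext => v /=.
have [->|v0] := eqVneq v 0; first by rewrite linear0.
have nv0 : `|v| != 0 by rewrite normr_eq0.
have : `|f (`|v|^-1 *: v)| <= 0.
  by rewrite -f0 dual_norm_ge// normrZ normfV normr_id mulVf.
rewrite normr_le0 linearZ/= => /eqP/(congr1 ( *:%R `|v|)).
by rewrite scalerA mulfV// scale1r scaler0.
Qed.

Lemma dual_normZ (a : R) (f : dual) :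
  restr_norm (a *: f) setT = `|a| * restr_norm f setT.
Proof.
have le_norm b (g : dual) :
    restr_norm (b *: g) setT <= `|b| * restr_norm g setT.
  apply: dual_norm_le => v v1.
  by rewrite [leLHS]normrM ler_wpM2l// dual_norm_ge.
apply/eqP; rewrite eq_le le_norm/=.
have [->|a0] := eqVneq a 0.
  rewrite normr0 mul0r; apply: le_trans (dual_norm_ge _ (v := 0) _) => //.
  by rewrite normr0.
rewrite -ler_pdivlMl ?normr_gt0// -normfV.
by rewrite -[X in restr_norm X]scale1r -(mulVf a0) -scalerA le_norm.
Qed.

HB.instance Definition _ := Lmodule_isNormed.Build R dual
  dual_normD dual_normZ dual_norm0_eq0.

End Dual.
Arguments dual {R} X.

Section Span.
Context {R : realType} {V : lmodType R}.

Definition lspan (A : set V) : set V :=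
  [set v | exists n (a : 'I_n -> R) (u : 'I_n -> V),
     (forall i, A (u i)) /\ v = \sum_i a i *: u i].

End Span.

Section Frames.
Context {R : realType} {X : normedModType R}.
Implicit Types (x : nat -> X) (f : nat -> dual X).

Definition schauder_frame x f :=
  [/\ forall i, x i != 0, forall i, f i != 0 &
      forall v, [series f i v *: x i]_i @ \oo --> v].

Definition locally_shrinking x f :=
  forall m, restr_norm (f m) (lspan [set x i | i in [set i | (n <= i)%N]])
              @[n --> \oo] --> (0 : R).

Definition pre_shrinking x f :=
  forall g : dual X, [series (g (x i) : R) *: f i]_i @ \oo --> g.

Definition shrinking_frame x f := locally_shrinking x f /\ pre_shrinking x f.

Definition block_sequence x (u : nat -> X) :=
  exists (k : nat -> nat) (a : nat -> R),
    (forall n, (k n < k n.+1)%N) /\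
    (forall n, u n = \sum_(k n <= i < k n.+1) a i *: x i).

Definition weakly_null (u : nat -> X) :=
  forall g : dual X, g (u n) @[n --> \oo] --> (0 : R).

End Frames.

Section Bases.
Context {R : realType} {Z : normedModType R}.

Definition schauder_basis (e : nat -> Z) :=
  forall z : Z, exists! a : nat -> R, [series a i *: e i]_i @ \oo --> z.

(* The coordinate functionals [c] are determined by [e], by uniqueness of the
   expansions. *)
Definition shrinking_basis (e : nat -> Z) :=
  schauder_basis e /\
  exists c : nat -> dual Z,
    (forall z : Z, [series (c i z : R) *: e i]_i @ \oo --> z) /\
    closure (lspan (range c)) = setT.

End Bases.

Section MinimalSpace.
Context {R : realType} {X : normedModType R}.

(* The space c_00 of eventually vanishing sequences is {poly R}: the sequence
   of coefficients of [a] is i |-> a`_i, and the i-th unit vector is 'X^i.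
   Only finitely many values occur below, so that the supremum is a maximum. *)
Definition min_norm (x : nat -> X) (a : {poly R}) : R :=
  sup [set `|\sum_(mn.1 <= i < mn.2.+1) a`_i *: x i|
      | mn in [set mn : nat * nat | (mn.1 <= mn.2)%N]].

(* [Z] is a completion of c_00 for the norm [min_norm x], with canonical
   map [J]. *)
Definition minimal_space (x : nat -> X) (Z : completeNormedModType R)
    (J : {linear {poly R} -> Z}) :=
  (forall a, `|J a| = min_norm x a) /\ closure (range J) = setT.

Definition min_basis (Z : completeNormedModType R)
    (J : {linear {poly R} -> Z}) (i : nat) : Z := J 'X^i.

End MinimalSpace.

(* [minimal_space_exists]: sending [a] to the family of its partial sums
   indexed by (m, n) embeds c_00 isometrically into the bounded functions
   nat * nat -> X; the completion is the uniform closure of the image. *)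
Section Existence.
Context {R : realType} {X : completeNormedModType R} (x : nat -> X).

Definition isum (a : {poly R}) (mn : nat * nat) : X :=
  \sum_(mn.1 <= i < mn.2.+1) a`_i *: x i.

Lemma isum_linear : linear isum.
Proof.
move=> b p q; apply/funext => mn; rewrite /isum !fctE scaler_sumr -big_split/=.
by apply: eq_bigr => i _; rewrite coefD coefZ scalerDl scalerA.
Qed.
HB.instance Definition _ :=
  GRing.isLinear.Build R {poly R} (nat * nat -> X) _ isum isum_linear.

Lemma isum_bounded a : exists M, forall mn, `|isum a mn| <= M.
Proof.
pose F i := `|a`_i *: x i|.
have F0 p q : 0 <= \sum_(p <= i < q) F i.
  by rewrite sumr_ge0// => i _; exact: normr_ge0.
exists (\sum_(0 <= i < size a) F i) => -[m n]; rewrite /isum/=.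
have [nm|mn] := ltnP n m; first by rewrite big_geq// normr0.
apply: (le_trans (ler_norm_sum _ _ _)); rewrite -/(F _).
apply: (@le_trans _ _ (\sum_(0 <= i < n.+1 + size a) F i)).
  rewrite [leRHS](@big_cat_nat _ _ _ m)//=; last by rewrite (leq_trans (leqW mn))// leq_addr.
  rewrite [X in _ <= _ + X](@big_cat_nat _ _ _ n.+1)//= ?leq_addr ?(leqW mn)//.
  by rewrite addrCA lerDl addr_ge0.
rewrite (@big_cat_nat _ _ _ (size a))//= ?leq_addl//.
rewrite [X in _ + X <= _]big_nat_cond [X in _ + X <= _]big1 ?addr0// => i /andP[/andP[ai _] _].
by rewrite /F nth_default// scale0r normr0.
Qed.

Definition zmin_pred : {pred nat * nat -> X} :=
  [pred g | `[< forall e, 0 < e ->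
     exists a, forall mn, `|g mn - isum a mn| <= e >]].

Record zmin :=
  Zmin {zmin_val :> nat * nat -> X; zmin_valP : zmin_val \in zmin_pred}.
HB.instance Definition _ := [isSub for zmin_val].
HB.instance Definition _ := [Choice of zmin by <:].

Lemma zmin_submod_closed : submod_closed zmin_pred.
Proof.
split.
  by apply/asboolP => e e0; exists 0 => mn; rewrite linear0 subrr normr0 ltW.
move=> b g h /asboolP gP /asboolP hP; apply/asboolP => e e0.
have b0 : 0 < `|b| + 1 by rewrite ltr_pwDr.
have [p pg] := gP (e / 2 / (`|b| + 1)) ltac:(by rewrite !divr_gt0).
have [q qh] := hP (e / 2) ltac:(by rewrite divr_gt0).
exists (b *: p + q) => mn; rewrite linearP/= !fctE.
rewrite opprD addrACA -scalerBr (le_trans (ler_normD _ _))// [leRHS]splitr lerD//.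
rewrite normrZ (le_trans (ler_wpM2l _ (pg mn)))//.
rewrite mulrA ler_pdivrMr// mulrC ler_wpM2l ?lerDl//.
by rewrite divr_ge0// ltW.
Qed.
HB.instance Definition _ :=
  GRing.isSubmodClosed.Build R (nat * nat -> X) zmin_pred zmin_submod_closed.
HB.instance Definition _ := [SubChoice_isSubLmodule of zmin by <:].

Lemma zmin_ub (g : zmin) : has_sup [set `|g mn| | mn in setT].
Proof.
split; first by exists `|g (0%N, 0%N)|; exists (0%N, 0%N).
have /asboolP/(_ _ ltr01)[a ga] := zmin_valP g.
have [M aM] := isum_bounded a.
exists (1 + M) => _ [mn _ <-].
by rewrite -(subrK (isum a mn) (g mn)) (le_trans (ler_normD _ _))// lerD.
Qed.

Definition zmin_norm (g : zmin) : R := sup [set `|g mn| | mn in setT].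

Lemma zmin_norm_ge (g : zmin) mn : `|g mn| <= zmin_norm g.
Proof. by apply: sup_upper_bound; [exact: zmin_ub|exists mn]. Qed.

Lemma zmin_norm_le (g : zmin) M : (forall mn, `|g mn| <= M) -> zmin_norm g <= M.
Proof.
move=> gM; apply: ge_sup; first by case: (zmin_ub g).
by move=> _ [mn _ <-]; exact: gM.
Qed.

Lemma zmin_normD g h : zmin_norm (g + h) <= zmin_norm g + zmin_norm h.
Proof.
apply: zmin_norm_le => mn; apply: (le_trans (ler_normD _ _)).
by rewrite lerD// zmin_norm_ge.
Qed.

Lemma zmin_norm0_eq0 g : zmin_norm g = 0 -> g = 0.
Proof.
move=> g0; apply: val_inj; apply/funext => mn /=.
by apply/eqP; rewrite -normr_le0 -g0 zmin_norm_ge.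
Qed.

Lemma zmin_normZ (a : R) g : zmin_norm (a *: g) = `|a| * zmin_norm g.
Proof.
have le_norm b (h : zmin) : zmin_norm (b *: h) <= `|b| * zmin_norm h.
  by apply: zmin_norm_le => mn; rewrite [leLHS]normrZ ler_wpM2l// zmin_norm_ge.
apply/eqP; rewrite eq_le le_norm/=.
have [->|a0] := eqVneq a 0.
  by rewrite normr0 mul0r; apply: le_trans (zmin_norm_ge _ (0%N, 0%N)).
rewrite -ler_pdivlMl ?normr_gt0// -normfV.
by rewrite -[X in zmin_norm X]scale1r -(mulVf a0) -scalerA le_norm.
Qed.

HB.instance Definition _ := Lmodule_isNormed.Build R zmin
  zmin_normD zmin_normZ zmin_norm0_eq0.

Lemma zmin_complete (F : set_system zmin) : ProperFilter F -> cauchy F -> cvg F.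
Proof.
move=> FF Fc.
have Fe (e : R) : 0 < e -> \forall g & h \near F, forall mn, `|(g : zmin) mn - (h : zmin) mn| < e.
  move=> e0; move/cauchy_ballP : Fc => /(_ _ e0); rewrite near_simpl.
  apply: filterS => -[g h] /=; rewrite -ball_normE/= => gh mn.
  exact: le_lt_trans (zmin_norm_ge (g - h) mn) gh.
have Fev mn : cvg ((fun g : zmin => g mn) @ F).
  apply: cauchy_cvg; apply/cauchy_ballP => e e0; rewrite near_map2.
  have := Fe _ e0; apply: filterS => -[g h] /= /(_ mn).
  by rewrite -ball_normE.
pose l mn := lim ((fun g : zmin => g mn) @ F).
have Fl (e : R) : 0 < e -> \forall g \near F, forall mn, `|(g : zmin) mn - l mn| <= e.
  move=> e0; have := Fe _ e0 => /nearP_dep; apply: filterS => g gh mn.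
  have cl : (fun h : zmin => `|g mn - h mn|) @ F --> `|g mn - l mn|.
    by apply: cvg_norm; apply: cvgB; [exact: cvg_cst|exact: Fev].
  apply: (closed_cvg (fun r => r <= e)) cl; first exact: closed_le.
  by apply: filterS gh => h /(_ mn)/ltW.
have lP : l \in zmin_pred.
  apply/asboolP => e e0; have e20 : 0 < e / 2 by rewrite divr_gt0.
  have [g gl] := filter_ex (Fl _ e20).
  have /asboolP/(_ _ e20)[a ga] := zmin_valP g.
  exists a => mn; rewrite -(subrK (g mn) (l mn)) -addrA [leRHS]splitr.
  by rewrite (le_trans (ler_normD _ _))// lerD// distrC.
apply/cvg_ex; exists (Zmin lP); apply/cvgrPdist_le => e e0.
apply: filterS (Fl _ e0) => g gl; apply: zmin_norm_le => mn.
by rewrite distrC; exact: gl.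
Qed.
HB.instance Definition _ := Uniform_isComplete.Build zmin zmin_complete.

Lemma isum_zmin a : isum a \in zmin_pred.
Proof. by apply/asboolP => e /ltW e0; exists a => mn; rewrite subrr normr0. Qed.

Definition zmin_inj a : zmin := Zmin (isum_zmin a).

Lemma zmin_inj_linear : linear zmin_inj.
Proof. by move=> b p q; apply: val_inj; rewrite /= linearP. Qed.
HB.instance Definition _ :=
  GRing.isLinear.Build R {poly R} zmin _ zmin_inj zmin_inj_linear.

End Existence.

Lemma minimal_space_exists (R : realType) (X : completeNormedModType R)
    (x : nat -> X) :
  exists (Z : completeNormedModType R) (J : {linear {poly R} -> Z}),
    minimal_space x J.
Proof.
exists (zmin x : completeNormedModType R), (zmin_inj x : {linear _ -> _}).
split=> [a|].
  rewrite [LHS]/(zmin_norm _) /zmin_norm /min_norm; apply/eqP; rewrite eq_le.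
  have ub : has_ubound [set `|\sum_(mn.1 <= i < mn.2.+1) a`_i *: x i|
      | mn in [set mn : nat * nat | (mn.1 <= mn.2)%N]].
    have [M aM] := isum_bounded x a.
    by exists M => _ [mn _ <-]; exact: aM.
  apply/andP; split; apply: ge_sup.
  - by exists `|isum x a (0%N, 0%N)|; exists (0%N, 0%N).
  - move=> _ [[m n] _ <-] /=; have [nm|mn] := ltnP n m.
      rewrite /isum big_geq// normr0; apply: (@le_trans _ _ `|isum x a (0%N, 0%N)|) => //.
      by apply: ub_le_sup => //; exists (0%N, 0%N).
    by apply: ub_le_sup => //; exists (m, n).
  - by exists `|isum x a (0%N, 0%N)|; exists (0%N, 0%N).
  - by move=> _ [mn _ <-]; exact: (zmin_norm_ge (zmin_inj x a) mn).
apply/seteqP; split=> // g _ B /nbhs_ballP[e /= e0 eB].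
have e20 : 0 < e / 2 by rewrite divr_gt0.
have /asboolP/(_ _ e20)[a ga] := zmin_valP g.
exists (zmin_inj x a); split; first by exists a.
apply: eB; rewrite -ball_normE/=; apply: (@le_lt_trans _ _ (e / 2)).
  by apply: zmin_norm_le => mn; exact: ga.
by rewrite ltr_pdivrMr// ltr_pMr// ltr1n.
Qed.

(* Main.v *)
From HB Require Import structures.
Require Import Defs.
From mathcomp Require Import all_boot all_order all_algebra.
From mathcomp Require Import all_classical all_reals all_analysis.
From mathcomp Require Import lra.
Import Order.TTheory GRing.Theory Num.Theory.
Import numFieldNormedType.Exports.
Local Open Scope classical_set_scope.
Local Open Scope ring_scope.

(** The property that links the four conditions is a uniform smallness on
tails: a functional [g] vanishes on tails when, for every [e > 0], the
inequality [`|g v| <= e * `|v|] holds on [span (x_i : i >= N)] for some [N].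
Such functionals form a closed subspace of the dual, and local shrinkingness
says that it contains every [f m].

(1) => (2): for a shrinking frame the span of the [f m] is dense, so every
functional vanishes on tails
([closure_span_vanishes_on_tails]), and a normalized block sequence runs
through the tails.

(2) => (3): the block sums [\sum_(m <= i < n) f i v *: x i] are bounded by
[K * `|v|], by the uniform boundedness principle.  If [g] is not the norm limit
of its expansion [\sum_i g (x i) *: f i], then [`|g|] is at least [e * `|v|] on
block sums that start arbitrarily far; after normalization they form a block
sequence on which [`|g|] stays above [e / K]
([weakly_null_blocks_pre_shrinking]).

(4) => (1): the map [e_i |-> x_i] extends to a contraction from Z_Min to X, and
[g] pulls back to a functional [G] on Z_Min.  If the coordinate functionals
have dense span, [G] is close to a functional that kills almost all unit
vectors.  The block sum with coefficients [f i v] has norm at most [K * `|v|]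
in Z_Min, so [g] is uniformly small on block sums that start far enough
([shrinking_basis_pre_shrinking]).

(3) => (4): here lies the difficulty.  Let [zs] be a functional on Z_Min that
does not become small on tails: it is at least [d] on vectors of norm at most 1
supported arbitrarily far.  The admissible vectors supported from [N] on form a
convex set, whose image in X comes arbitrarily close to 0: otherwise
Hahn-Banach gives a functional on X bounded below by a positive constant on
that image, although functionals on X vanish on tails ([small_synthesis]).
Now add [L] such vectors with successive supports and with images of norm at
most [e].  A sum over an interval of indices consists of complete vectors, each
contributing at most [e], and at most two truncated ones, each contributing at
most 1.  So the minimal norm of the sum is at most [2 + L * e], while [zs] is at
least [L * d] there, which is absurd for small [e] and large [L]
([large_on_tails_absurd]).  Hence [zs] is small on tails, which means that it
is approximated by its expansion along the coordinate functionals.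

Both uses of Hahn-Banach, the separation just described and the extension of
functionals from c_00 to Z_Min, are instances of one statement on convex cones
of constraints [r <= g v] ([cone_separation]). *)

(** * Sublinear functionals and separation *)

Section Sublinear.
Context {R : realType} {V : lmodType R}.
Implicit Types (p q : V -> R) (A : set (V * R)) (u v w : V).

Definition sublinear q :=
  (forall u v, q (u + v) <= q u + q v) /\
  (forall t v, 0 <= t -> q (t *: v) <= t * q v).

Lemma sublinear0 q : sublinear q -> q 0 = 0.
Proof.
move=> [qD qZ]; have := qD 0 0; have := qZ 0 0 (lexx 0).
by rewrite scale0r addr0 mul0r => ? ?; lra.
Qed.

Lemma sublinear_oppr q v : sublinear q -> - q (- v) <= q v.
Proof. by move=> sq; have := sq.1 v (- v); rewrite subrr sublinear0//; lra. Qed.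

Definition convex_cone A :=
  [/\ A (0, 0), forall a b, A a -> A b -> A (a.1 + b.1, a.2 + b.2) &
      forall t a, 0 <= t -> A a -> A (t *: a.1, t * a.2)].

(** The witness is [fun w => inf_(a in A) (q (w + a.1) - a.2)], which is finite
because [q (w + a.1) - a.2 >= q a.1 - q (- w) - a.2 >= - q (- w)].  A linear
functional below it satisfies [a.2 <= g a.1] on [A]. *)
Lemma sublinear_lower_cone q A : sublinear q -> convex_cone A ->
  (forall a, A a -> a.2 <= q a.1) ->
  exists p, [/\ sublinear p, forall v, p v <= q v &
                forall a, A a -> p (- a.1) <= - a.2].
Proof.
move=> sq [A0 AD AZ] Aq; have [qD qZ] := sq.
pose S w := [set q (w + a.1) - a.2 | a in A].
have Sn w : S w !=set0 by exists (q (w + 0) - 0), (0, 0).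
have Sb w : has_lbound (S w).
  exists (- q (- w)) => _ [a Aa <-].
  have := Aq _ Aa; have := qD (w + a.1) (- w); rewrite addrAC subrr add0r.
  lra.
have ple w a : A a -> inf (S w) <= q (w + a.1) - a.2.
  by move=> Aa; apply: ge_inf => //; exists a.
have leZ t w a : 0 <= t -> A a -> inf (S (t *: w)) <= t * (q (w + a.1) - a.2).
  move=> t0 Aa; apply: (le_trans (ple _ _ (AZ _ _ t0 Aa))) => /=.
  by rewrite -scalerDr mulrBr lerD2r qZ.
exists (fun w => inf (S w)); split; last 2 first.
- by move=> v; have := ple v _ A0; rewrite /= addr0 subr0.
- by move=> a /(ple (- a.1)); rewrite addNr sublinear0// sub0r.
split=> [u v|t v].
- rewrite -lerBlDr; apply: lb_le_inf => // _ [a Aa <-].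
  rewrite lerBlDl -lerBlDr; apply: lb_le_inf => // _ [b Ab <-].
  rewrite lerBlDl; apply: (le_trans (ple _ _ (AD _ _ Aa Ab))) => /=.
  by rewrite addrACA; have := qD (u + a.1) (v + b.1); lra.
- rewrite le_eqVlt => /orP[/eqP<-|t0].
    by have := leZ 0 v _ (lexx 0) A0; rewrite !mul0r.
  rewrite -ler_pdivrMl//; apply: lb_le_inf => // _ [a Aa <-].
  by rewrite ler_pdivrMl// leZ// ltW.
Qed.

(** Zorn's lemma for the reverse pointwise order: the infimum of a chain is
subadditive because two members of the chain are comparable, and it is bounded
below at [v] by [- q (- v)]. *)
Lemma minimal_sublinear q : sublinear q -> exists p,
  [/\ sublinear p, forall v, p v <= q v &
      forall p', sublinear p' -> (forall v, p' v <= p v) -> p' = p].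
Proof.
move=> sq.
pose P p := `[< sublinear p /\ forall v, p v <= q v >].
pose T := {p | P p}.
pose le' (s t : T) := `[< forall v, val t v <= val s v >].
have TP (t : T) : sublinear (val t) /\ forall v, val t v <= q v.
  by apply/asboolP; exact: valP t.
have [||||t tmax] := @Zorn T le'.
- by move=> t; apply/asboolP.
- move=> r s t /asboolP rs /asboolP st; apply/asboolP => v.
  exact: le_trans (st v) (rs v).
- move=> s t /asboolP st /asboolP ts; apply: val_inj; apply/funext => v.
  by apply/eqP; rewrite eq_le ts st.
- move=> A Atot.
  have [An|nA] := pselect (A !=set0); last first.
    have Pq : P q by apply/asboolP.
    by exists (exist _ q Pq) => s As; exfalso; apply: nA; exists s.
  pose S v := [set val t v | t in A].
  have Sn v : S v !=set0 by have [t At] := An; exists (val t v), t.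
  have Sb v : has_lbound (S v).
    exists (- q (- v)) => _ [t _ <-]; have [st tq] := TP t.
    have := sublinear_oppr _ v st; have := tq (- v); lra.
  have pl t v : A t -> inf (S v) <= val t v.
    by move=> At; apply: ge_inf => //; exists t.
  have Pp : P (fun v => inf (S v)).
    apply/asboolP; split; last first.
      by move=> v; have [t At] := An; exact: le_trans (pl _ _ At) ((TP t).2 v).
    split=> [u v|r v].
      rewrite -lerBlDr; apply: lb_le_inf => // _ [s As <-].
      rewrite lerBlDl -lerBlDr; apply: lb_le_inf => // _ [t At <-].
      rewrite lerBlDl.
      have [/asboolP st|/asboolP ts] := Atot _ _ As At.
        apply: (le_trans (pl _ _ At)); apply: (le_trans ((TP t).1.1 u v)).
        by rewrite lerD2r st.
      apply: (le_trans (pl _ _ As)); apply: (le_trans ((TP s).1.1 u v)).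
      by rewrite lerD2l ts.
    rewrite le_eqVlt => /orP[/eqP<-|r0].
      have [t At] := An; rewrite mul0r scale0r -(sublinear0 _ (TP t).1).
      exact: pl.
    rewrite -ler_pdivrMl//; apply: lb_le_inf => // _ [t At <-].
    rewrite ler_pdivrMl//; apply: (le_trans (pl _ _ At)).
    by apply: (TP t).1.2; exact: ltW.
  by exists (exist P (fun v => inf (S v)) Pp) => s As; apply/asboolP => v /=; exact: pl.
exists (val t); have [st tq] := TP t; split=> // p' sp' p't.
have Pp' : P p'.
  by apply/asboolP; split=> // v; exact: le_trans (p't v) (tq v).
by rewrite -(tmax (exist _ p' Pp'))//; apply/asboolP.
Qed.

(** Lowering [p] by the half-line through [(v, p v)] yields a sublinear [p']
below [p] with [p' (- v) <= - p v].  By minimality [p' = p], so [p] is odd, and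
an odd sublinear function is linear. *)
Lemma minimal_sublinear_linear p : sublinear p ->
  (forall p', sublinear p' -> (forall v, p' v <= p v) -> p' = p) ->
  linear (p : V -> R^o).
Proof.
move=> sp pmin; have [pD pZ] := sp.
have pN v : p (- v) = - p v.
  pose A := [set a : V * R | exists2 t, 0 <= t & a = (t *: v, t * p v)].
  have [||p' [sp' p'p p'A]] := sublinear_lower_cone p A sp.
  - split.
    + by exists 0; rewrite ?scale0r ?mul0r.
    + move=> _ _ [s s0 ->] [t t0 ->]; exists (s + t); rewrite ?addr_ge0//=.
      by rewrite scalerDl mulrDl.
    + move=> r _ r0 [t t0 ->]; exists (r * t); rewrite ?mulr_ge0//=.
      by rewrite scalerA mulrA.
  - move=> _ [t t0 ->] /=.
    have [->|tn0] := eqVneq t 0; first by rewrite scale0r mul0r sublinear0.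
    rewrite -ler_pdivlMl ?lt_neqAle ?t0 1?eq_sym ?tn0//.
    by have := pZ t^-1 (t *: v); rewrite scalerA mulVf// scale1r invr_ge0; apply.
  have p'E := pmin _ sp' p'p; rewrite p'E in p'A.
  apply/eqP; rewrite eq_le.
  have /= -> : p (- v) <= - p v.
    by apply: (p'A (v, p v)); exists 1; rewrite ?scale1r ?mul1r.
  by have := sublinear_oppr _ v sp; lra.
have pZE t v : 0 <= t -> p (t *: v) = t * p v.
  move=> t0; apply/eqP; rewrite eq_le pZ//=.
  by have := pZ t (- v) t0; rewrite scalerN !pN mulrN lerN2.
have pDE u v : p (u + v) = p u + p v.
  apply/eqP; rewrite eq_le pD/=.
  by have := pD (- u) (- v); rewrite -opprD !pN; lra.
move=> a u v; rewrite pDE; congr (_ + _).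
have [a0|a0] := leP 0 a; first exact: pZE.
rewrite -[a]opprK scaleNr pN pZE ?oppr_ge0 ?ltW//.
by rewrite scaleNr.
Qed.

(** Hahn-Banach theorem, with the constraints [a.2 <= g a.1] for [a] in a convex
cone.  With a graph as the cone it extends a linear functional; with the cone
over [C * {e}] it separates the convex set [C] from 0. *)
Lemma cone_separation q A : sublinear q -> convex_cone A ->
  (forall a, A a -> a.2 <= q a.1) ->
  exists g : V -> R^o, [/\ linear g, forall v, g v <= q v &
                           forall a, A a -> a.2 <= g a.1].
Proof.
move=> sq cA Aq; have [p [sp pq pA]] := sublinear_lower_cone q A sq cA Aq.
have [g [sg gp gmin]] := minimal_sublinear p sp.
have lg := minimal_sublinear_linear g sg gmin.
exists g; split=> // [v|a Aa]; first exact: le_trans (gp v) (pq v).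
have := sublinear_oppr _ (- a.1) sg; rewrite opprK.
by have := gp (- a.1); have := pA a Aa; lra.
Qed.

End Sublinear.

Section NormedSeparation.
Context {R : realType} {X : normedModType R}.

Lemma bounded_linear_dual (g : X -> R^o) C : linear g ->
  (forall v, `|g v| <= C * `|v|) -> exists g' : dual X, forall v, g' v = g v.
Proof.
move=> lg gC.
pose h : {linear X -> R^o} := HB.pack g (GRing.isLinear.Build _ _ _ _ _ lg).
have ch : continuous h.
  apply/linear_bounded_continuous/bounded_funP => r.
  exists (`|C| * `|r|) => v vr; apply: (le_trans (gC v)).
  rewrite (le_trans (ler_wpM2r _ (ler_norm C)))// ler_wpM2l//.
  by rewrite (le_trans vr)// ler_norm.
have gP : g \in dual_pred by apply/asboolP.
by exists (Dual gP).
Qed.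

(** [cone_separation] for [fun v => C * `|v|], the form in which it produces
elements of the dual. *)
Lemma normed_cone_separation (C : R) (A : set (X * R)) : 0 <= C ->
  convex_cone A -> (forall a, A a -> a.2 <= C * `|a.1|) ->
  exists g : dual X, (forall v, `|g v| <= C * `|v|) /\
                     forall a, A a -> a.2 <= g a.1.
Proof.
move=> C0 cA AC.
have sC : sublinear (fun v : X => C * `|v|).
  split=> [u v|t v t0]; first by rewrite -mulrDr ler_wpM2l// ler_normD.
  by rewrite normrZ ger0_norm// mulrCA.
have [g [lg gC gA]] := cone_separation _ A sC cA AC.
have gN v : g (- v) = - g v.
  pose h : {linear X -> R^o} :=
    HB.pack g (GRing.isLinear.Build _ _ _ _ _ lg).
  exact: (linearN h).
have gC' v : `|g v| <= C * `|v|.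
  rewrite ler_norml gC andbT lerNl -gN -[`|v|]normrN; exact: gC.
have [g' g'E] := bounded_linear_dual g C lg gC'.
by exists g'; split=> [v|a]; rewrite g'E//; exact: gA.
Qed.

End NormedSeparation.

(** * Approximation, dual norms and linear spans *)

Section NormFacts.
Context {R : realType}.

Lemma closure_dist {V : normedModType R} (A : set V) (z : V) (e : R) :
  closure A z -> 0 < e -> exists2 a, A a & `|z - a| < e.
Proof.
move=> Az e0; have [a [Aa za]] := Az _ (nbhsx_ballx z e e0).
by exists a => //; move: za; rewrite -ball_normE.
Qed.

Lemma dist_closure_setT {V : normedModType R} (A : set V) :
  (forall (z : V) (e : R), 0 < e -> exists2 a, A a & `|z - a| < e) ->
  closure A = setT.
Proof.
move=> Ad; apply/seteqP; split=> // z _ B /nbhs_ballP[e /= e0 eB].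
have [a Aa za] := Ad z e e0; exists a; split=> //.
by apply: eB; rewrite -ball_normE.
Qed.

Lemma dual_le {V : normedModType R} (g : dual V) v : `|g v| <= `|g| * `|v|.
Proof.
have [->|v0] := eqVneq v 0; first by rewrite linear0 !normr0 mulr0.
have nv : 0 < `|v| by rewrite normr_gt0.
have := @dual_norm_ge _ _ g (`|v|^-1 *: v).
rewrite normrZ normfV normr_id mulVf ?gt_eqF// => /(_ (lexx _)).
by rewrite linearZ [X in X <= _]normrM normfV normr_id ler_pdivrMl// mulrC.
Qed.

Lemma dual_norm_bound {V : normedModType R} (g : dual V) (C : R) : 0 <= C ->
  (forall v, `|g v| <= C * `|v|) -> `|g| <= C.
Proof.
move=> C0 gC; apply: dual_norm_le => v v1; apply: (le_trans (gC v)).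
by rewrite -[leRHS]mulr1 ler_wpM2l.
Qed.

Lemma lspan_ind {V : lmodType R} (A P : set V) : P 0 ->
  (forall a u v, A u -> P v -> P (a *: u + v)) -> lspan A `<=` P.
Proof.
move=> P0 PD _ [n [a [u [Au ->]]]].
elim: n a u Au => [|n IHn] a u Au; first by rewrite big_ord0.
rewrite big_ord_recl; apply: PD => //.
by apply: (IHn (fun i => a (lift ord0 i)) (fun i => u (lift ord0 i))) => i.
Qed.

Lemma lspanZ {V : lmodType R} (A : set V) (b : R) v :
  lspan A v -> lspan A (b *: v).
Proof.
move=> [n [a [u [Au ->]]]]; exists n, (fun i => b * a i), u; split=> //.
by rewrite scaler_sumr; apply: eq_bigr => i _; rewrite scalerA.
Qed.

Lemma lspan_sum {V : lmodType R} (A : set V) (a : nat -> R) (u : nat -> V) m n :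
  (forall i, (m <= i)%N -> A (u i)) -> lspan A (\sum_(m <= i < n) a i *: u i).
Proof.
move=> Au; exists (n - m)%N, (fun i => a (i + m)%N), (fun i => u (i + m)%N).
split; first by move=> i; apply: Au; rewrite leq_addl.
by rewrite -{1}(add0n m) big_addn big_mkord.
Qed.

Lemma restr_norm_ge {V : normedModType R} (g : dual V) (E : set V) v :
  (forall (a : R) u, E u -> E (a *: u)) -> E v ->
  `|g v| <= restr_norm g E * `|v|.
Proof.
move=> EZ Ev.
have [->|v0] := eqVneq v 0; first by rewrite linear0 !normr0 mulr0.
have nv : 0 < `|v| by rewrite normr_gt0.
rewrite mulrC -ler_pdivrMl// -[X in X * _]ger0_norm ?invr_ge0//.
rewrite -[leLHS](normrM (`|v|^-1) (g v)).
have -> : `|v|^-1 * g v = g (`|v|^-1 *: v) by rewrite linearZ.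
apply: ub_le_sup; last first.
  exists (`|v|^-1 *: v) => //; split; first exact: EZ.
  by rewrite normrZ normfV normr_id mulVf ?gt_eqF.
have [M gM] := restr_norm_ubound g; exists M => _ [u [_ u1] <-].
by apply: gM; exists u.
Qed.

End NormFacts.

(** * Functionals on the tails of a frame *)

Section Frames.
Context {R : realType} {X : completeNormedModType R}.
Context (x : nat -> X) (f : nat -> dual X).

Definition tail_span n := lspan [set x i | i in [set i | (n <= i)%N]].

Definition vanishes_on_tails (g : dual X) := forall e : R, 0 < e ->
  exists N, forall v, tail_span N v -> `|g v| <= e * `|v|.

Lemma tail_span_anti m n : (m <= n)%N -> tail_span n `<=` tail_span m.
Proof.
move=> mn _ [k [a [u [Au ->]]]]; exists k, a, u; split=> // i.
by have [j /= nj <-] := Au i; exists j => //=; exact: leq_trans nj.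
Qed.

Lemma tail_span_sum (a : nat -> R) m n k : (m <= n)%N ->
  tail_span m (\sum_(n <= i < k) a i *: x i).
Proof.
move=> mn; apply: lspan_sum => i ni; exists i => //=; exact: leq_trans ni.
Qed.

(** The functionals that vanish on tails form a norm-closed subspace. *)
Lemma closure_span_vanishes_on_tails (g : dual X) : locally_shrinking x f ->
  closure (lspan (range f)) g -> vanishes_on_tails g.
Proof.
move=> lsh cg.
have spanP : lspan (range f) `<=` vanishes_on_tails.
  apply: lspan_ind => [e e0|a _ h [m _ <-] ht e e0].
    by exists 0%N => v _; rewrite normr0 mulr_ge0// ltW.
  have a0 : 0 < `|a| + 1 by rewrite ltr_wpDl.
  have e2 : 0 < e / 2 by lra.
  have [N hN] := ht _ e2.
  have /cvgrPdist_le/(_ (e / 2 / (`|a| + 1)) (divr_gt0 e2 a0)) := lsh m.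
  move=> [N' _ fN']; exists (maxn N N') => v tv.
  have tvN := tail_span_anti _ _ (leq_maxl N N') _ tv.
  have tvN' := tail_span_anti _ _ (leq_maxr N N') _ tv.
  apply: (le_trans (ler_normD _ _)); rewrite {1}(splitr e) mulrDl.
  apply: lerD; last exact: hN.
  rewrite [leLHS]normrM.
  have := restr_norm_ge (f m) (tail_span N') v (@lspanZ _ _ _) tvN'.
  have := fN' N' (leqnn _); rewrite /= sub0r normrN.
  set r := restr_norm _ _ => rle fle.
  have {}fle : `|f m v| <= e / 2 / (`|a| + 1) * `|v|.
    by apply: (le_trans fle); rewrite ler_wpM2r// (le_trans (ler_norm _)).
  apply: (@le_trans _ _ ((`|a| + 1) * `|f m v|)).
    by rewrite ler_wpM2r// lerDl.
  rewrite -ler_pdivlMl// (le_trans fle)//.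
  by rewrite mulrA [X in X * _ <= _]mulrC.
move=> e e0; have e2 : 0 < e / 2 by lra.
have [h hs gh] := closure_dist _ _ _ cg e2.
have [N hN] := spanP h hs _ e2; exists N => v tv.
have -> : g v = (g - h) v + h v by rewrite [(g - h) v]/(g v - h v) subrK.
apply: (le_trans (ler_normD _ _)); rewrite {1}(splitr e) mulrDl.
apply: lerD; last exact: hN.
by apply: (le_trans (dual_le _ _)); rewrite ler_wpM2r// ltW.
Qed.

Lemma ltn_incr_ge (k : nat -> nat) : (forall n, k n < k n.+1)%N ->
  forall n, (n <= k n)%N.
Proof. by move=> kS; elim=> // n IHn; exact: leq_ltn_trans (kS n). Qed.

Lemma vanishes_on_tails_blocks : (forall g, vanishes_on_tails g) ->
  forall u, block_sequence x u -> (forall n, `|u n| = 1) -> weakly_null u.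
Proof.
move=> van u [k [a [kS uE]]] u1 g; apply/cvgrPdist_le => e e0.
have [N gN] := van g e e0; exists N => // n /= Nn.
rewrite sub0r normrN -[leRHS]mulr1 -(u1 n); apply: gN.
rewrite uE; apply: tail_span_sum; exact: leq_trans (ltn_incr_ge _ kS n).
Qed.

(** The blocks [[k n, k n.+1)] are disjoint; the index of the block of [i] is the
least [n] with [i < k n.+1]. *)
Lemma glue_blocks (k : nat -> nat) (b : nat -> nat -> R) :
  (forall n, k n < k n.+1)%N ->
  exists a : nat -> R, forall n i, (k n <= i < k n.+1)%N -> a i = b n i.
Proof.
move=> kS.
have ex i : exists n, (i < k n.+1)%N by exists i; exact: (ltn_incr_ge _ kS i.+1).
exists (fun i => b (ex_minn (ex i)) i) => n i /andP[kni ikn].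
case: ex_minnP => m ikm mmin; congr (b _ _).
have mono : {homo k : p q / (p <= q)%N} := homo_leq leqnn leq_trans (fun n => ltnW (kS n)).
apply/eqP; rewrite eqn_leq mmin//= leqNgt; apply/negP => mn.
by have := leq_trans ikm (leq_trans (mono _ _ mn) kni); rewrite ltnn.
Qed.

(** Turns vectors with property [P], available arbitrarily far along [x], into
one block sequence: each block starts where the previous one ends, so the
choice of [M] determines all endpoints by iteration. *)
Lemma block_sequence_choice (P : X -> Prop) :
  (forall N, exists M (b : nat -> R), (N < M)%N /\
     P (\sum_(N <= i < M) b i *: x i)) ->
  exists u, block_sequence x u /\ forall n, P (u n).
Proof.
move=> /choice[M /choice[b Mb]].
pose k n := iter n M 0%N.
have kS n : (k n < k n.+1)%N by case: (Mb (k n)).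
have [a aE] := glue_blocks k (fun n => b (k n)) kS.
exists (fun n => \sum_(k n <= i < k n.+1) a i *: x i); split.
  by exists k, a.
move=> n; rewrite (eq_big_nat _ _ (F2 := fun i => b (k n) i *: x i)).
  by case: (Mb (k n)).
by move=> i /aE ->.
Qed.

Hypothesis frame_xf : schauder_frame x f.

Definition frame_sum m n (v : X) : X := \sum_(m <= i < n) (f i v : R) *: x i.

(** Banach-Steinhaus for the partial sum operators, which converge pointwise. *)
Lemma frame_sum_bounded :
  exists2 K : R, 0 < K & forall m n v, `|frame_sum m n v| <= K * `|v|.
Proof.
have [_ _ fr] := frame_xf.
pose F := [set frame_sum 0 n | n in setT].
have lin m n : linear (frame_sum m n).
  move=> a u v; rewrite /frame_sum scaler_sumr -big_split/=.
  by apply: eq_bigr => i _; rewrite linearP scalerDl scalerA.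
have bndF n : bounded_fun_norm (frame_sum 0 n).
  move=> r; exists (\sum_(0 <= i < n) `|f i| * r * `|x i|) => v vr.
  apply: (le_trans (ler_norm_sum _ _ _)); apply: ler_sum => i _.
  rewrite normrZ ler_wpM2r//; apply: (le_trans (dual_le _ _)).
  by rewrite ler_wpM2l.
have ptF : pointwise_bounded F.
  move=> v; have /cvgP/cvg_seq_bounded/pinfty_ex_gt0[M _ Mb] := fr v.
  by exists M => _ [n _ <-]; exact: Mb.
have [|M FM] := @Banach_Steinhauss _ _ _ F _ ptF 1.
  by move=> _ [n _ <-]; split; [exact: bndF|exact: lin].
have FM' n v : `|frame_sum 0 n v| <= `|M| * `|v|.
  have [->|v0] := eqVneq v 0.
    rewrite normr0 mulr0 /frame_sum big1 ?normr0// => i _.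
    by rewrite linear0 scale0r.
  have nv : 0 < `|v| by rewrite normr_gt0.
  have := FM (frame_sum 0 n) (ex_intro2 _ _ n I erefl) (`|v|^-1 *: v).
  have -> : frame_sum 0 n (`|v|^-1 *: v) = `|v|^-1 *: frame_sum 0 n v.
    by have := lin 0%N n (`|v|^-1) v 0; rewrite !addr0 => ->;
      rewrite [frame_sum 0 n 0]big1 ?addr0// => i _; rewrite linear0 scale0r.
  rewrite !normrZ normfV normr_id mulVf ?gt_eqF// => /(_ (lexx _)).
  rewrite ler_pdivrMl// mulrC => /le_trans; apply.
  by rewrite ler_wpM2r// ler_norm.
exists (`|M| + `|M| + 1) => [|m n v]; first by rewrite ltr_wpDl// addr_ge0.
have [mn|nm] := leqP m n; last first.
  by rewrite /frame_sum big_geq ?normr0 ?mulr_ge0 ?addr_ge0// ltnW.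
have -> : frame_sum m n v = frame_sum 0 n v - frame_sum 0 m v.
  by rewrite {2}/frame_sum (@big_cat_nat _ _ _ m 0%N n)//= addrAC subrr add0r.
rewrite mulrDl (le_trans (ler_normB _ _))// -[leLHS]addr0.
by rewrite mul1r mulrDl !lerD.
Qed.

Lemma dual_sumE {V : normedModType R} (a : nat -> R) (h : nat -> dual V) m n v :
  (\sum_(m <= i < n) a i *: h i : dual V) v = \sum_(m <= i < n) a i * h i v.
Proof.
elim/big_rec2: _ => // i s g _ <-.
by rewrite [LHS]/(a i * h i v + g v).
Qed.

(** The [n]-th partial sum of the expansion of [g] is [g] composed with the
[n]-th partial sum operator of the frame, so its distance to [g] is the norm of
[g] on the remainders, which are limits of block sums. *)
Lemma pre_shrinking_criterion :
  (forall (g : dual X) (e : R), 0 < e ->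
    exists N, forall m n v, (N <= m)%N -> `|g (frame_sum m n v)| <= e * `|v|) ->
  pre_shrinking x f.
Proof.
have [_ _ fr] := frame_xf => small g; apply/cvgrPdist_le => e e0.
have [N gN] := small g e e0; exists N => // n /= Nn.
apply: dual_norm_bound => [|v]; first exact: ltW.
have -> : (g - [series (g (x i) : R) *: f i]_i n) v = g (v - frame_sum 0 n v).
  rewrite [RHS]linearB [in RHS]linear_sum [LHS]/(g v - _); congr (_ - _).
  by rewrite [LHS]dual_sumE; apply: eq_bigr => i _; rewrite linearZ/= mulrC.
have cv : `|g (frame_sum 0 m v - frame_sum 0 n v)| @[m --> \oo] -->
    `|g (v - frame_sum 0 n v)|.
  apply: cvg_norm; apply: continuous_cvg; first exact: dual_continuous.
  by apply: cvgB; [exact: fr|exact: cvg_cst].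
apply: (closed_cvg (fun r : R => r <= e * `|v|)) cv; first exact: closed_le.
exists n => // m /= nm.
have -> : frame_sum 0 m v - frame_sum 0 n v = frame_sum n m v.
  by rewrite {1}/frame_sum (@big_cat_nat _ _ _ n 0%N m)//= addrAC subrr add0r.
exact: gN.
Qed.

(** If the block sums [w] of [v] violate the criterion, then
[`|g w| > e * `|v| >= e / K * `|w|], so normalizing them gives block vectors on
which [`|g|] is at least [e / K]. *)
Lemma weakly_null_blocks_pre_shrinking :
  (forall u, block_sequence x u -> (forall n, `|u n| = 1) -> weakly_null u) ->
  pre_shrinking x f.
Proof.
move=> wn; apply: pre_shrinking_criterion => g e e0.
apply: contrapT => /forallNP big.
have [K K0 fK] := frame_sum_bounded.
have [|u [bu uP]] := block_sequence_choice (fun w => `|w| = 1 /\ e / K <= `|g w|).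
  move=> N; have /existsNP[n /existsNP[m /existsNP[v /not_implyP[Nn]]]] := big N.
  move=> /negP; rewrite -ltNge; set w := frame_sum n m v => gw.
  have w0 : w != 0.
    apply/eqP => w0; move: gw; rewrite w0 linear0 normr0.
    by rewrite ltNge mulr_ge0// ltW.
  have nm : (n < m)%N.
    by rewrite ltnNge; apply/negP => mn; case/eqP: w0; rewrite /w /frame_sum big_geq.
  have nw : 0 < `|w| by rewrite normr_gt0.
  (* The block has to start at [N]: pad with zero coefficients up to [n]. *)
  exists m, (fun i => if (n <= i)%N then `|w|^-1 * f i v else 0).
  split; first exact: leq_ltn_trans nm.
  have -> : \sum_(N <= i < m) (if (n <= i)%N then `|w|^-1 * f i v else 0) *: x i
      = `|w|^-1 *: w.
    rewrite (@big_cat_nat _ _ _ n)//= ?(ltnW nm)// big_nat big1 ?add0r.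
      rewrite scaler_sumr; apply: eq_big_nat => i /andP[ni _].
      by rewrite ni scalerA.
    by move=> i /andP[_ ni]; rewrite leqNgt ni scale0r.
  rewrite normrZ normfV normr_id mulVf ?gt_eqF//; split=> //.
  rewrite linearZ [leRHS]normrM normfV normr_id.
  rewrite ler_pdivlMl// (le_trans _ (ltW gw))// mulrCA ler_wpM2l ?(ltW e0)//.
  by rewrite ler_pdivrMr// mulrC fK.
have /cvgrPdist_lt/(_ (e / K) (divr_gt0 e0 K0))[N _ /(_ N (leqnn _))] :=
  wn u bu (fun n => (uP n).1) g.
by rewrite /= sub0r normrN ltNge (uP N).2.
Qed.

Lemma pre_shrinking_closure_span :
  pre_shrinking x f -> closure (lspan (range f)) = setT.
Proof.
move=> pre; apply: dist_closure_setT => g e e0.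
have /cvgrPdist_lt/(_ e e0)[N _ /(_ N (leqnn _)) gN] := pre g.
exists ([series (g (x i) : R) *: f i]_i N) => //.
by apply: lspan_sum => i _; exists i.
Qed.

End Frames.

(** * The minimal associated space *)

Section MinimalSpace.
Context {R : realType} {X : completeNormedModType R} (x : nat -> X).
Implicit Types p q : {poly R}.

Definition interval_sum (p : {poly R}) m n : X := \sum_(m <= i < n) p`_i *: x i.

(** The canonical operator [e_i |-> x_i] from c_00 to X. *)
Definition synthesis (p : {poly R}) : X := interval_sum p 0 (size p).

Lemma interval_sum_linear m n : linear (fun p : {poly R} => interval_sum p m n).
Proof.
move=> a p q; rewrite /interval_sum scaler_sumr -big_split/=.
by apply: eq_bigr => i _; rewrite coefD coefZ scalerDl scalerA.
Qed.

Lemma interval_sum0 p m n : (forall i, (m <= i < n)%N -> p`_i = 0) ->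
  interval_sum p m n = 0.
Proof.
by move=> p0; rewrite /interval_sum big_nat big1// => i /p0 ->; rewrite scale0r.
Qed.

Lemma interval_sum_cat k p m n : (m <= k <= n)%N ->
  interval_sum p m n = interval_sum p m k + interval_sum p k n.
Proof. by move=> /andP[mk kn]; rewrite /interval_sum (@big_cat_nat _ _ _ k). Qed.

Lemma eq_interval_sum p q m n : (forall i, (m <= i < n)%N -> p`_i = q`_i) ->
  interval_sum p m n = interval_sum q m n.
Proof. by move=> pq; apply: eq_big_nat => i /pq ->. Qed.

Lemma synthesisE p n : (size p <= n)%N -> synthesis p = interval_sum p 0 n.
Proof.
move=> pn; rewrite (interval_sum_cat (size p) p 0 n)//.
rewrite [X in _ + X]interval_sum0 ?addr0// => i /andP[pi _].
by rewrite nth_default.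
Qed.

Lemma synthesis_linear : linear synthesis.
Proof.
move=> a p q; pose n := maxn (size (a *: p + q)) (maxn (size p) (size q)).
rewrite !(synthesisE _ n) ?interval_sum_linear//.
- by rewrite /n !leq_max leqnn !orbT.
- by rewrite /n !leq_max leqnn !orbT.
- by rewrite /n !leq_max leqnn.
Qed.
HB.instance Definition _ :=
  GRing.isLinear.Build R {poly R} X _ synthesis synthesis_linear.

Context {Z : completeNormedModType R} {J : {linear {poly R} -> Z}}.
Hypothesis minimal_Z : minimal_space x J.

Lemma interval_sum_le p m n : `|interval_sum p m n| <= `|J p|.
Proof.
rewrite minimal_Z.1.
have ub : has_ubound [set `|\sum_(mn.1 <= i < mn.2.+1) p`_i *: x i|
      | mn in [set mn : nat * nat | (mn.1 <= mn.2)%N]].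
  have [M aM] := isum_bounded x p.
  by exists M => _ [mn _ <-]; exact: aM.
have [mn|nm] := ltnP m n; last first.
  rewrite /interval_sum big_geq// normr0.
  apply: (@le_trans _ _ `|interval_sum p 0 1|) => //.
  by apply: ub_le_sup => //; exists (0%N, 0%N).
case: n mn => // n mn.
by apply: ub_le_sup => //; exists (m, n).
Qed.

Lemma min_norm_bound p C :
  (forall m n, `|interval_sum p m n| <= C) -> `|J p| <= C.
Proof.
move=> pC; rewrite minimal_Z.1; apply: ge_sup.
  by exists `|interval_sum p 0 1|; exists (0%N, 0%N).
by move=> _ [mn _ <-]; exact: pC.
Qed.

Lemma synthesis_le p : `|synthesis p| <= `|J p|.
Proof. exact: interval_sum_le. Qed.

Lemma min_dense (z : Z) (e : R) : 0 < e -> exists p, `|z - J p| < e.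
Proof.
move=> e0; have : closure (range J) z by rewrite minimal_Z.2.
by move=> /closure_dist/(_ e0)[_ [p _ <-]] zp; exists p.
Qed.

Lemma min_dense_le (a b : Z -> R) : continuous a -> continuous b ->
  (forall p, a (J p) <= b (J p)) -> forall z, a z <= b z.
Proof.
move=> ca cb ab z; rewrite -subr_ge0.
have cl : closed [set w : Z | 0 <= b w - a w].
  apply: (@closed_comp _ _ (fun w => b w - a w) [set r : R | 0 <= r]).
    by move=> w _; apply: continuousB; [exact: cb|exact: ca].
  exact: closed_ge.
have : closure (range J) z by rewrite minimal_Z.2.
move=> /(closureS (_ : _ `<=` [set w : Z | 0 <= b w - a w])).
rewrite -((closure_id _).1 cl); apply => _ [p _ <-] /=.
by rewrite subr_ge0.
Qed.

(** Extension by [normed_cone_separation] for the graph of [phi]: on a linear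
graph the constraint [phi p <= G (J p)] at [p] and at [- p] is an equality. *)
Lemma min_extension (phi : {poly R} -> R^o) (C : R) : 0 <= C -> linear phi ->
  (forall p, `|phi p| <= C * `|J p|) ->
  exists G : dual Z, (forall z, `|G z| <= C * `|z|) /\ forall p, G (J p) = phi p.
Proof.
move=> C0 lphi phiC.
pose h : {linear {poly R} -> R^o} :=
  HB.pack phi (GRing.isLinear.Build _ _ _ _ _ lphi).
have hE p : phi p = h p by [].
have [||G [GC GA]] := normed_cone_separation C (range (fun p => (J p, phi p))) C0.
- split=> [|_ _ [p _ <-] [q _ <-]|t _ t0 [p _ <-]].
  + by exists 0; rewrite // hE !linear0.
  + by exists (p + q); rewrite // hE !linearD.
  + by exists (t *: p); rewrite // hE !linearZ.
- by move=> _ [p _ <-] /=; apply: (le_trans (ler_norm _)).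
have le p : phi p <= G (J p) by apply: (GA (J p, phi p)); exists p.
exists G; split=> // p; apply/eqP; rewrite eq_le le andbT.
by have := le (- p); rewrite hE !linearN lerN2.
Qed.

(** Truncation only removes indices from the intervals over which the maximum is
taken; with [min_norm_drop], the unit vectors are a bimonotone basis. *)
Lemma min_norm_take N p : `|J (take_poly N p)| <= `|J p|.
Proof.
apply: min_norm_bound => m n.
have -> : interval_sum (take_poly N p) m n = interval_sum p m (minn n N).
  have [nN|Nn] := leqP n N.
    by apply: eq_interval_sum => i /andP[_ i_n]; rewrite coef_take_poly (leq_trans i_n nN).
  have [Nm|mN] := leqP N m.
    rewrite [RHS]/interval_sum big_geq// interval_sum0// => i /andP[mi _].
    by rewrite coef_take_poly ltnNge (leq_trans Nm mi).
  rewrite (interval_sum_cat N) ?(ltnW mN) ?(ltnW Nn)//.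
  rewrite [X in _ + X]interval_sum0 ?addr0; last first.
    by move=> i /andP[Ni _]; rewrite coef_take_poly ltnNge Ni.
  by apply: eq_interval_sum => i /andP[_ iN]; rewrite coef_take_poly iN.
exact: interval_sum_le.
Qed.

Lemma min_norm_drop N p : `|J (p - take_poly N p)| <= `|J p|.
Proof.
apply: min_norm_bound => m n.
have tl i : (p - take_poly N p)`_i = if (i < N)%N then 0 else p`_i.
  by rewrite coefB coef_take_poly; case: ifP; rewrite ?subrr ?subr0.
have -> : interval_sum (p - take_poly N p) m n = interval_sum p (maxn m N) n.
  have [Nm|mN] := leqP N m.
    by apply: eq_interval_sum => i /andP[mi _]; rewrite tl ltnNge (leq_trans Nm mi).
  have [nN|Nn] := leqP n N.
    rewrite [RHS]/interval_sum big_geq// interval_sum0// => i /andP[_ i_n].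
    by rewrite tl (leq_trans i_n nN).
  rewrite (interval_sum_cat N) ?(ltnW mN) ?(ltnW Nn)//.
  rewrite [X in X + _]interval_sum0 ?add0r; last first.
    by move=> i /andP[_ iN]; rewrite tl iN.
  by apply: eq_interval_sum => i /andP[Ni _]; rewrite tl ltnNge Ni.
exact: interval_sum_le.
Qed.

(** The one-element interval [{i}] gives [`|p`_i| * `|x i| <= `|J p|], so the
[i]-th coordinate is bounded by [`|x i|^-1] in the minimal norm. *)
Lemma min_coordinates : (forall i, x i != 0) ->
  exists c : nat -> dual Z, forall i p, c i (J p) = p`_i.
Proof.
move=> x0.
suff /choice[c cE] : forall i, exists c : dual Z, forall p, c (J p) = p`_i.
  by exists c.
move=> i.
have nx : 0 < `|x i| by rewrite normr_gt0.
have [|||c [_ cE]] := min_extension (fun p => p`_i) `|x i|^-1 _ _ _.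
- by rewrite invr_ge0.
- by move=> a p q; rewrite coefD coefZ.
- move=> p; rewrite mulrC ler_pdivlMr// -normrZ.
  by have := interval_sum_le p i i.+1; rewrite /interval_sum big_nat1.
by exists c.
Qed.

Section Coordinates.
Context {c : nat -> dual Z}.
Hypothesis cJ : forall i p, c i (J p) = p`_i.

Lemma partial_sum_J n p :
  \sum_(0 <= i < n) (c i (J p) : R) *: min_basis J i = J (take_poly n p).
Proof.
rewrite /take_poly poly_def linear_sum big_mkord; apply: eq_bigr => i _.
by rewrite linearZ/= cJ.
Qed.

(** The partial sum operators are contractions on the range of [J], hence on [Z],
and eventually the identity at each [J p]. *)
Lemma min_basis_expansion z : [series (c i z : R) *: min_basis J i]_i @ \oo --> z.
Proof.
pose Q n w := \sum_(0 <= i < n) (c i w : R) *: min_basis J i.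
have Qc n : continuous (Q n).
  apply: continuous_big => [|i _ w]; first exact: add_continuous.
  by apply: cvgZr_tmp; exact: dual_continuous.
have Q1 n w : `|Q n w| <= `|w|.
  apply: (min_dense_le (fun w => `|Q n w|) (fun w => `|w|)).
  - by move=> v; apply: continuous_comp; [exact: Qc|exact: norm_continuous].
  - exact: norm_continuous.
  - by move=> p; rewrite /Q partial_sum_J min_norm_take.
have QB n v w : Q n (v - w) = Q n v - Q n w.
  by rewrite /Q -sumrB; apply: eq_bigr => i _; rewrite linearB scalerBl.
apply/cvgrPdist_le => e e0; have e2 : 0 < e / 2 by lra.
have [p zp] := min_dense z (e / 2) e2.
exists (size p) => // n /= pn; rewrite -[series _ n]/(Q n z).
have -> : z - Q n z = (z - J p) - Q n (z - J p).
  have QJ : Q n (J p) = J p by rewrite /Q partial_sum_J take_poly_id.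
  rewrite QB QJ.
  by rewrite opprB addrA subrK.
rewrite (le_trans (ler_normB _ _))// [leRHS]splitr lerD//.
  exact: ltW.
by rewrite (le_trans (Q1 _ _))// ltW.
Qed.

Lemma min_basis_schauder : schauder_basis (min_basis J).
Proof.
move=> z; exists (fun i => c i z); split; first exact: min_basis_expansion.
move=> a az; apply/funext => i.
have ci : c i ([series a j *: min_basis J j]_j n) @[n --> \oo] --> c i z.
  by apply: continuous_cvg => //; exact: dual_continuous.
have ca : c i ([series a j *: min_basis J j]_j n) @[n --> \oo] --> (a i : R^o).
  apply: cvg_near_cst; exists i.+1 => // n /= i_n.
  have -> : [series a j *: min_basis J j]_j n = J (\poly_(j < n) a j).
    rewrite poly_def linear_sum /series/= big_mkord.
    by apply: eq_bigr => j _; rewrite linearZ.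
  by rewrite cJ coef_poly i_n.
exact: (cvg_unique _ ci ca).
Qed.

End Coordinates.

End MinimalSpace.

(** * From a shrinking minimal basis to a pre-shrinking frame *)

Section ShrinkingBasisToFrame.
Context {R : realType} {X : completeNormedModType R}.
Context (x : nat -> X) (f : nat -> dual X).
Context (Z : completeNormedModType R) (J : {linear {poly R} -> Z}).
Hypothesis frame_xf : schauder_frame x f.
Hypothesis minimal_Z : minimal_space x J.
Implicit Types p : {poly R}.

(** [synthesis] is a contraction for the minimal norm, so functionals on X pull
back to Z_Min. *)
Lemma synthesis_functional (g : dual X) :
  exists G : dual Z, forall p, G (J p) = g (synthesis x p).
Proof.
have [|||G [_ GE]] :=
  min_extension (J := J) (fun p => g (synthesis x p)) `|g| _ _ _.
- exact: normr_ge0.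
- by move=> a p q; rewrite !linearP.
- move=> p; apply: (le_trans (dual_le _ _)).
  by rewrite ler_wpM2l// synthesis_le.
by exists G.
Qed.

Lemma J_sum p : J p = \sum_(0 <= i < size p) p`_i *: min_basis J i.
Proof.
rewrite -[in LHS](coefK p) poly_def linear_sum big_mkord.
by apply: eq_bigr => i _; rewrite linearZ.
Qed.

(** A basis vector also has the trivial expansion, and expansions are unique. *)
Lemma basis_coordinates (c : nat -> dual Z) : schauder_basis (min_basis J) ->
  (forall z : Z, [series (c i z : R) *: min_basis J i]_i @ \oo --> z) ->
  forall i j, c i (min_basis J j) = (i == j)%:R.
Proof.
move=> sb cE i j.
have [a [_ aU]] := sb (min_basis J j).
suff dE : [series (k == j)%:R *: min_basis J k]_k @ \oo --> min_basis J j.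
  have := aU _ (cE (min_basis J j)); rewrite (aU _ dE).
  by move/(congr1 (fun b : nat -> R => b i)).
apply: cvg_near_cst; exists j.+1 => // n /= jn.
rewrite /series/= (bigD1_seq j) ?iota_uniq ?mem_index_iota//=.
rewrite eqxx scale1r big1 ?addr0// => k /negPf ->.
by rewrite scale0r.
Qed.

(** Every interval sum of this vector of c_00 is again a block sum of the frame
expansion of [v]. *)
Lemma frame_sum_min_norm (K : R) n v :
  (forall m n v, `|frame_sum x f m n v| <= K * `|v|) ->
  `|J (\poly_(i < n) (f i v : R))| <= K * `|v|.
Proof.
move=> fK; apply: (min_norm_bound _ minimal_Z) => a b.
have -> : interval_sum x (\poly_(i < n) (f i v : R)) a b =
    frame_sum x f a (minn b n) v.
  have [bn|nb] := leqP b n.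
    apply: eq_big_nat => i /andP[_ ib].
    by rewrite coef_poly (leq_trans ib bn).
  have [na|an] := leqP n a.
    rewrite /frame_sum big_geq// interval_sum0// => i /andP[ai _].
    by rewrite coef_poly ltnNge (leq_trans na ai).
  rewrite (interval_sum_cat _ n) ?(ltnW an) ?(ltnW nb)//.
  rewrite [X in _ + X]interval_sum0 ?addr0; last first.
    by move=> i /andP[ni _]; rewrite coef_poly ltnNge ni.
  by apply: eq_big_nat => i /andP[_ i_n]; rewrite coef_poly i_n.
exact: fK.
Qed.

(** Pull [g] back to [G] and take [h] in the span of the coordinate functionals
with [`|G - h| < e / K].  On a block sum [J p] that starts beyond the support of
[h] one has [G (J p) = (G - h) (J p)], and [`|J p| <= K * `|v|]. *)
Lemma shrinking_basis_pre_shrinking :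
  shrinking_basis (min_basis J) -> pre_shrinking x f.
Proof.
move=> [sb [c [cE cd]]]; apply: (pre_shrinking_criterion _ _ frame_xf) => g e e0.
have [K K0 fK] := frame_sum_bounded _ _ frame_xf.
have [G GE] := synthesis_functional g.
have eK : 0 < e / K by rewrite divr_gt0.
have : closure (lspan (range c)) G by rewrite cd.
move=> /closure_dist/(_ eK)[h hs Gh].
have [N hN] : exists N, forall j, (N <= j)%N -> h (min_basis J j) = 0 :> R.
  apply: (lspan_ind _ (fun h : dual Z =>
    exists N, forall j, (N <= j)%N -> h (min_basis J j) = 0 :> R) _ _ _ hs).
    by exists 0%N.
  move=> a _ h' [i _ <-] [N hN]; exists (maxn i.+1 N) => j.
  rewrite geq_max => /andP[ij Nj].
  rewrite [LHS]/(a * c i (min_basis J j) + h' (min_basis J j)).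
  rewrite (basis_coordinates _ sb cE) ltn_eqF// mulr0 [LHS]add0r; exact: hN.
exists N => m n v Nm.
pose q := \poly_(i < n) (f i v : R); pose p := q - take_poly m q.
have pE i : p`_i = if (m <= i < n)%N then (f i v : R) else 0.
  rewrite coefB coef_take_poly coef_poly.
  by case: (ltnP i m) => im; rewrite ?subrr ?subr0.
have psz : (size p <= n)%N.
  by apply/leq_sizeP => i ni; rewrite pE [(i < n)%N]ltnNge ni andbF.
have [nm|mn] := leqP n m.
  by rewrite /frame_sum big_geq// linear0 normr0 mulr_ge0// ltW.
have <- : synthesis x p = frame_sum x f m n v.
  rewrite (synthesisE _ _ _ psz) (interval_sum_cat _ m) ?(ltnW mn)//.
  rewrite interval_sum0 ?add0r; last first.
    by move=> i /andP[_ im]; rewrite pE leqNgt im.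
  by apply: eq_big_nat => i im; rewrite pE im.
have hp : h (J p) = 0 :> R.
  rewrite J_sum linear_sum big1// => i _.
  rewrite linearZ [LHS]/(p`_i * h (min_basis J i)) pE.
  case: ifP => [/andP[mi _]|_]; last by rewrite [LHS]mul0r.
  by rewrite (hN i (leq_trans Nm mi)) [LHS]mulr0.
rewrite -GE -[G (J p)]subr0 -hp -[_ - _]/((G - h) (J p)).
apply: (le_trans (dual_le _ _)).
apply: (@le_trans _ _ (e / K * (K * `|v|))); last first.
  by rewrite mulrA divfK ?gt_eqF.
apply: ler_pM => //; first exact: ltW.
apply: (le_trans (min_norm_drop _ minimal_Z m q)); exact: frame_sum_min_norm.
Qed.

End ShrinkingBasisToFrame.

(** * From functionals vanishing on tails to a shrinking minimal basis *)

Section FrameToShrinkingBasis.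
Context {R : realType} {X : completeNormedModType R}.
Context (x : nat -> X).
Context (Z : completeNormedModType R) (J : {linear {poly R} -> Z}).
Hypothesis minimal_Z : minimal_space x J.
Hypothesis vanishing : forall g : dual X, vanishes_on_tails x g.
Implicit Types p : {poly R}.

Definition supported_from N p := forall i, (i < N)%N -> p`_i = 0.

Lemma supported_from_synthesis N p : supported_from N p ->
  tail_span x N (synthesis x p).
Proof.
move=> pN.
rewrite (synthesisE x p (maxn N (size p))) ?leq_maxr//.
rewrite (interval_sum_cat x N) ?leq_maxl// interval_sum0 ?add0r; last first.
  by move=> i /andP[_ /pN].
exact: tail_span_sum.
Qed.

(** The hypothesis [large] negates, up to scaling, that [zs] is small on
tails; the section derives a contradiction from it. *)
Section LargeOnTails.
Context (zs : dual Z) (d : R).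
Hypothesis d0 : 0 < d.
Hypothesis large : forall N, exists p,
  [/\ supported_from N p, `|J p| <= 1 & d <= zs (J p)].

(** A form of Mazur's lemma.  The cone [A] consists of the multiples of pairs
[(synthesis p, e)] with [p] admissible: for [t > 0] its conditions say that
[t^-1 *: p] is admissible.  If no admissible [p] has [`|synthesis p| <= e], the
constraints of [A] are dominated by the norm, and the separating [g] satisfies
[e <= g (synthesis p)] for all admissible [p].  This contradicts that [g]
vanishes on tails. *)
Lemma small_synthesis (e : R) N : 0 < e -> exists p,
  [/\ supported_from N p, `|J p| <= 1, d <= zs (J p) & `|synthesis x p| <= e].
Proof.
move=> e0; apply: contrapT => none.
pose A := [set a : X * R | exists p t,
  [/\ supported_from N p, `|J p| <= t, d * t <= zs (J p) &
      a = (synthesis x p, e * t)]].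
have [||g [g1 gA]] := normed_cone_separation 1 A ler01.
- split.
  + exists 0, 0; rewrite !linear0 normr0 !mulr0; split=> // i _.
    by rewrite coef0.
  + move=> _ _ [p [s [pN ps dp ->]]] [q [t [qN qt dq ->]]].
    exists (p + q), (s + t); rewrite linearD; split=> /=.
    * by move=> i iN; rewrite coefD pN// qN// addr0.
    * by rewrite (le_trans (ler_normD _ _))// lerD.
    * by rewrite linearD mulrDr lerD.
    * by rewrite linearD mulrDr.
  + move=> r _ r0 [p [t [pN pt dp ->]]]; exists (r *: p), (r * t).
    rewrite linearZ; split=> /=.
    * by move=> i iN; rewrite coefZ pN// mulr0.
    * by rewrite normrZ ger0_norm// ler_wpM2l.
    * by rewrite linearZ mulrCA ler_wpM2l.
    * by rewrite linearZ mulrCA.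
- move=> _ [p [t [pN pt dp ->]]] /=; rewrite mul1r leNgt; apply/negP => pe.
  have t0 : 0 < t by rewrite -(pmulr_rgt0 t e0) (le_lt_trans _ pe).
  apply: none; exists (t^-1 *: p); split.
  + by move=> i iN; rewrite coefZ pN// mulr0.
  + by rewrite linearZ normrZ gtr0_norm ?invr_gt0// ler_pdivrMl// mulr1.
  + by rewrite !linearZ [leRHS]/(t^-1 * _) ler_pdivlMl// mulrC.
  + rewrite linearZ.
    by rewrite normrZ gtr0_norm ?invr_gt0// ler_pdivrMl// mulrC ltW.
have e2 : 0 < e / 2 by lra.
have [N1 gN1] := vanishing g _ e2.
have [p [pN p1 dp]] := large (maxn N N1).
have /gA/= : A (synthesis x p, e * 1).
  exists p, 1; split=> //; last by rewrite mulr1.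
  by move=> i iN; apply: pN; rewrite leq_max iN.
have pt : tail_span x N1 (synthesis x p).
  by apply: supported_from_synthesis => i iN; apply: pN; rewrite leq_max iN orbT.
rewrite mulr1 => eg.
have := le_trans eg (le_trans (ler_norm _) (gN1 _ pt)).
have : e / 2 * `|synthesis x p| <= e / 2.
  rewrite -[leRHS]mulr1 ler_wpM2l ?(ltW e2)//.
  exact: le_trans (synthesis_le x minimal_Z p) p1.
by lra.
Qed.

(** A new vector [w], with short image, is put in front of the stack [p]; the
supports are separated at [s].  An interval sum that starts at 0 contains [w]
completely or does not reach [p], which keeps the first bound at one truncated
vector.  An arbitrary interval sum truncates [w] on the left and then covers
[p] from its beginning, whence the bound with two truncated vectors. *)
Lemma stacked_blocks (e : R) L N : 0 < e -> exists p,
  [/\ supported_from N p, forall n, `|interval_sum x p 0 n| <= 1 + L%:R * e,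
      `|J p| <= 2 + L%:R * e & L%:R * d <= zs (J p)].
Proof.
move=> e0; elim: L N => [|L IHL] N.
  exists 0; split.
  - by move=> i _; rewrite coef0.
  - by move=> n; rewrite interval_sum0 ?normr0 ?mul0r ?addr0// => i _; rewrite coef0.
  - by rewrite linear0 normr0; lra.
  - by rewrite !linear0 mul0r.
have [w [wN w1 dw we]] := small_synthesis e N e0.
pose s := maxn N (size w).
have [p [ps p0 p2 dp]] := IHL s.
have Le : 0 <= L%:R * e by rewrite mulr_ge0// ltW.
have LS : L.+1%:R = L%:R + 1 :> R by rewrite -natr1.
have wps m n : interval_sum x (w + p) m n =
    interval_sum x w m n + interval_sum x p m n.
  by have := interval_sum_linear x m n 1 w p; rewrite !scale1r.
have w1' m n := le_trans (interval_sum_le x minimal_Z w m n) w1.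
exists (w + p); split.
- move=> i iN; rewrite coefD wN// ps ?addr0//.
  by rewrite /s leq_max iN.
- move=> n; rewrite wps; have [ns|sn] := leqP n s.
    rewrite [X in _ + X]interval_sum0 ?addr0; last first.
      by move=> i /andP[_ i_n]; apply: ps; exact: leq_trans ns.
    by have := w1' 0%N n; rewrite LS; nra.
  rewrite -synthesisE; last by rewrite (leq_trans _ (ltnW sn))// leq_maxr.
  by have := ler_normD (synthesis x w) (interval_sum x p 0 n);
    have := p0 n; rewrite LS; nra.
- apply: (min_norm_bound _ minimal_Z) => m n.
  rewrite wps; have [ns|sn] := leqP n s.
    rewrite [X in _ + X]interval_sum0 ?addr0; last first.
      by move=> i /andP[_ i_n]; apply: ps; exact: leq_trans ns.
    by have := w1' m n; rewrite LS; nra.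
  have [ms|sm] := leqP m s.
    have <- : interval_sum x p 0 n = interval_sum x p m n.
      rewrite (interval_sum_cat x m) ?(leq_trans ms (ltnW sn))//.
      rewrite interval_sum0 ?add0r// => i /andP[_ im].
      by apply: ps; exact: leq_trans ms.
    have := ler_normD (interval_sum x w m n) (interval_sum x p 0 n).
    by have := p0 n; have := w1' m n; rewrite LS; nra.
  rewrite interval_sum0 ?add0r; last first.
    move=> i /andP[mi _]; rewrite nth_default//.
    by rewrite (leq_trans _ mi)// (leq_trans _ (ltnW sm))// leq_maxr.
  by have := interval_sum_le x minimal_Z p m n; rewrite LS; nra.
- by rewrite !linearD LS mulrDl mul1r addrC lerD.
Qed.

(** The stack gives [L * d <= `|zs| * (2 + L * e)].  The choice
[e = d / 2 / (`|zs| + 1)] reduces this to [L * d / 2 <= 2 * `|zs|]. *)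
Lemma large_on_tails_absurd : False.
Proof.
have z0 : 0 < `|zs| + 1 by rewrite ltr_wpDl.
pose e := d / 2 / (`|zs| + 1).
have e0 : 0 < e by rewrite !divr_gt0.
have ze : `|zs| * e <= d / 2.
  by rewrite /e mulrCA ler_piMr ?divr_ge0 ?(ltW d0)// ler_pdivrMr// mul1r lerDl.
pose L := Num.bound (4 * `|zs| / d).
have Ld : 4 * `|zs| < L%:R * d.
  by rewrite -ltr_pdivrMr// archi_boundP// divr_ge0 ?mulr_ge0// ltW.
have [p [_ _ p2 dp]] := stacked_blocks e L 0 e0.
have zp : zs (J p) <= `|zs| * (2 + L%:R * e).
  apply: (le_trans (ler_norm _)); apply: (le_trans (dual_le _ _)).
  by rewrite ler_wpM2l.
have Lze : L%:R * (`|zs| * e) <= L%:R * (d / 2) by rewrite ler_wpM2l.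
by move: zp; rewrite mulrDr mulrCA; lra.
Qed.

End LargeOnTails.

Lemma min_functional_small_on_tails (zs : dual Z) (d : R) : 0 < d ->
  exists N, forall p, supported_from N p -> `|zs (J p)| <= d * `|J p|.
Proof.
move=> d0; apply: contrapT => /forallNP none.
apply: (large_on_tails_absurd zs d d0) => N.
have /existsNP[p /not_implyP[pN /negP]] := none N; rewrite -ltNge => dp.
have Jp0 : 0 < `|J p|.
  rewrite normr_gt0; apply/eqP => Jp0.
  by move: dp; rewrite Jp0 linear0 !normr0 mulr0 ltxx.
exists ((Num.sg (zs (J p)) / `|J p|) *: p); split.
- by move=> i iN; rewrite coefZ pN// mulr0.
- rewrite linearZ normrZ normrM normfV normr_id divfK ?gt_eqF//.
  by rewrite normr_sg lern1 leq_b1.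
- have -> : zs (J ((Num.sg (zs (J p)) / `|J p|) *: p)) = `|zs (J p)| / `|J p|.
    rewrite !linearZ [LHS]/(Num.sg (zs (J p) : R) / `|J p| * zs (J p)).
    by rewrite [LHS]mulrAC -normrEsg.
  by rewrite ler_pdivlMr// ltW.
Qed.

(** If [zs] is small on vectors supported from [N] on, it is close to
[\sum_(i < N) zs e_i *: c i]: their difference at [J p] is the value of [zs] at
the part of [p] supported from [N] on. *)
Lemma vanishing_shrinking_basis : (forall i, x i != 0) ->
  shrinking_basis (min_basis J).
Proof.
move=> x0; have [c cJ] := min_coordinates x minimal_Z x0.
split; first exact: (min_basis_schauder x minimal_Z cJ).
exists c; split; first exact: (min_basis_expansion x minimal_Z cJ).
apply: dist_closure_setT => zs e e0; have e2 : 0 < e / 2 by lra.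
have [N zN] := min_functional_small_on_tails zs (e / 2) e2.
exists (\sum_(0 <= i < N) (zs (min_basis J i) : R) *: c i).
  by apply: lspan_sum => i _; exists i.
set h := \sum_(_ <= _ < _) _.
apply: (@le_lt_trans _ _ (e / 2)); last by lra.
apply: dual_norm_bound; first exact: ltW.
apply: (min_dense_le x minimal_Z (fun z => `|(zs - h) z|) (fun z => e / 2 * `|z|)).
- move=> z; apply: continuous_comp; last exact: norm_continuous.
  exact: dual_continuous.
- move=> z; apply: cvgM; [exact: cvg_cst|exact: norm_continuous].
move=> p; have -> : (zs - h) (J p) = zs (J (p - take_poly N p)).
  rewrite [LHS]/(zs (J p) - h (J p)) !linearB; congr (_ - _).
  rewrite /h dual_sumE -(partial_sum_J cJ) linear_sum.
  by apply: eq_bigr => i _; rewrite linearZ mulrC.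
apply: (@le_trans _ _ (e / 2 * `|J (p - take_poly N p)|)).
  by apply: zN => i iN; rewrite coefB coef_take_poly iN subrr.
by rewrite ler_wpM2l ?(ltW e2)// (min_norm_drop x minimal_Z).
Qed.

End FrameToShrinkingBasis.

Theorem theoremA (R : realType) (X : completeNormedModType R)
    (x : nat -> X) (f : nat -> dual X)
    (Z : completeNormedModType R) (J : {linear {poly R} -> Z})
    (frame_xf : schauder_frame x f)
    (lshrink_xf : locally_shrinking x f)
    (minimal_Z : minimal_space x J) :
  [<-> shrinking_frame x f;
       forall u : nat -> X, block_sequence x u -> (forall n, `|u n| = 1) ->
         weakly_null u;
       closure (lspan (range f)) = setT;
       shrinking_basis (min_basis J)].
Proof.
have van : closure (lspan (range f)) = setT -> forall g, vanishes_on_tails x g.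
  by move=> cf g; apply: closure_span_vanishes_on_tails lshrink_xf _; rewrite cf.
tfae.
- by move=> [_ /pre_shrinking_closure_span/van/vanishes_on_tails_blocks].
- by move=> /(weakly_null_blocks_pre_shrinking _ _ frame_xf)/pre_shrinking_closure_span.
- by move=> /van vg; apply: vanishing_shrinking_basis => //; case: frame_xf.
- by move=> sb; split=> //; exact: shrinking_basis_pre_shrinking sb.
Qed.
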